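(* Let $(N,\mu,\nu)$ be an intuitionistic fuzzy normed space, let $(u_k)_{k\ge 1}$ be a sequence in $N$, let $a\in N$ and let $m\ge 1$ be an integer. If $(u_k)$ is statistically $(L,m)$ summable to $a$ and slowly oscillating with respect to logarithmic summability, then $(u_k)$ is convergent to $a$ in $(N,\mu,\nu)$.
   Context: An intuitionistic fuzzy normed space (IFNS) is a triple $(N,\mu,\nu)$ where $N$ is a real vector space with zero vector $\theta$ and $\mu,\nu:N\times\mathbb{R}\to[0,1]$ satisfy, for all $u,w\in N$ and $t,s\in\mathbb{R}$: (a) $\mu(u,t)=0$ for $t\le 0$; (b) $\mu(u,t)=1$ for all $t>0$ if and only if $u=\theta$; (c) $\mu(cu,t)=\mu(u,t/|c|)$ for all $t>0$ and real $c\ne 0$; (d) $\mu(u+w,t+s)\ge\min\{\mu(u,t),\mu(w,s)\}$; (e) $\lim_{t\to\infty}\mu(u,t)=1$, and $\lim_{t\to 0}\mu(u,t)=0$ if $u\neq\theta$; (f) $\nu(u,t)=1$ for $t\le 0$; (g) $\nu(u,t)=0$ for all $t>0$ if and only if $u=\theta$; (h) $\nu(cu,t)=\nu(u,t/|c|)$ for all $t>0$ and real $c\neq 0$; (i) $\max\{\nu(u,t),\nu(w,s)\}\ge\nu(u+w,t+s)$; (j) $\lim_{t\to\infty}\nu(u,t)=0$, and $\lim_{t\to0}\nu(u,t)=1$ if $u\ne\theta$. A sequence $(u_k)$ in $N$ is convergent to $a\in N$ if for every $\varepsilon>0$ and $t>0$ there is $k_0\in\mathbb{N}$ such that $\mu(u_k-a,t)>1-\varepsilon$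 and $\nu(u_k-a,t)<\varepsilon$ for all $k\ge k_0$. A sequence $(v_k)$ in $N$ is statistically convergent to $a\in N$ with respect to $(\mu,\nu)$ if for every $\varepsilon>0$ and $t>0$, $\lim_{n\to\infty}\frac1n\left|\{k\le n:\mu(v_k-a,t)\le 1-\varepsilon\text{ or }\nu(v_k-a,t)\ge\varepsilon\}\right|=0$. With $\ell_k=\sum_{j=1}^k\frac1j$, the higher order logarithmic means of $(u_k)$ are defined recursively by $L^0_k=u_k$ and $L^m_k=\frac{1}{\ell_k}\sum_{j=1}^k\frac{L^{m-1}_j}{j}$ for $m\ge 1$. $(u_k)$ is statistically $(L,m)$ summable to $a$ if the sequence $(L^m_k)_{k\ge1}$ is statistically convergent to $a$. $(u_k)$ is slowly oscillating with respect to logarithmic summability if for all $t>0$ and all $\varepsilon\in(0,1)$ there exist $\lambda>1$ and $m_0\in\mathbb{N}$ (depending on $t$ and $\varepsilon$) such that $\mu(u_k-u_n,t)>1-\varepsilon$ and $\nu(u_k-u_n,t)<\varepsilon$ whenever $m_0\le n<k\le\lfloor n^{\lambda}\rfloor$. *)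

(* Defs.v *)
From HB Require Import structures.
From mathcomp Require Import all_boot all_order all_algebra.
From mathcomp Require Import all_classical all_reals all_analysis.

Set Implicit Arguments.
Unset Strict Implicit.
Unset Printing Implicit Defensive.

Import Order.TTheory GRing.Theory Num.Theory.
Import numFieldNormedType.Exports.

Local Open Scope classical_set_scope.
Local Open Scope ring_scope.

Record IFNS (R : realType) (N : lmodType R) (mu nu : N -> R -> R) : Prop := {
  ifns_mu_range : forall (u : N) (t : R), 0 <= mu u t <= 1;
  ifns_nu_range : forall (u : N) (t : R), 0 <= nu u t <= 1;
  ifns_mu_le0 : forall (u : N) (t : R), t <= 0 -> mu u t = 0;
  ifns_mu_eq1 : forall u : N, (forall t : R, 0 < t -> mu u t = 1) <-> u = 0;
  ifns_muZ : forall (u : N) (c t : R), 0 < t -> c != 0 ->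
    mu (c *: u) t = mu u (t / `|c|);
  ifns_muD : forall (u w : N) (t s : R),
    Num.min (mu u t) (mu w s) <= mu (u + w) (t + s);
  ifns_mu_pinfty : forall u : N, mu u t @[t --> +oo] --> (1 : R);
  ifns_mu_0 : forall u : N, u != 0 -> mu u t @[t --> 0^'] --> (0 : R);
  ifns_nu_le0 : forall (u : N) (t : R), t <= 0 -> nu u t = 1;
  ifns_nu_eq0 : forall u : N, (forall t : R, 0 < t -> nu u t = 0) <-> u = 0;
  ifns_nuZ : forall (u : N) (c t : R), 0 < t -> c != 0 ->
    nu (c *: u) t = nu u (t / `|c|);
  ifns_nuD : forall (u w : N) (t s : R),
    nu (u + w) (t + s) <= Num.max (nu u t) (nu w s);
  ifns_nu_pinfty : forall u : N, nu u t @[t --> +oo] --> (0 : R);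
  ifns_nu_0 : forall u : N, u != 0 -> nu u t @[t --> 0^'] --> (1 : R)
}.

(* A sequence (u_k)_{k >= 1} is a function u : nat -> N whose value at 0 is
   never significant. *)

Definition ifns_cvg (R : realType) (N : lmodType R) (mu nu : N -> R -> R)
    (u : nat -> N) (a : N) : Prop :=
  forall eps t : R, 0 < eps -> 0 < t ->
    exists k0 : nat, forall k : nat, (k0 <= k)%N ->
      1 - eps < mu (u k - a) t /\ nu (u k - a) t < eps.

Definition ifns_stat_cvg (R : realType) (N : lmodType R) (mu nu : N -> R -> R)
    (v : nat -> N) (a : N) : Prop :=
  forall eps t : R, 0 < eps -> 0 < t ->
    n%:R^-1 * (count (fun k => (mu (v k - a) t <= 1 - eps)
                               || (eps <= nu (v k - a) t))
                     (index_iota 1 n.+1))%:R @[n --> \oo] --> (0 : R).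

Definition log_weight (R : realType) (k : nat) : R :=
  \sum_(1 <= j < k.+1) j%:R^-1.

Fixpoint log_mean (R : realType) (N : lmodType R) (u : nat -> N) (m : nat)
    : nat -> N :=
  if m is m'.+1 then
    fun k => (log_weight R k)^-1 *:
               \sum_(1 <= j < k.+1) j%:R^-1 *: log_mean u m' j
  else u.

Definition stat_log_summable (R : realType) (N : lmodType R)
    (mu nu : N -> R -> R) (m : nat) (u : nat -> N) (a : N) : Prop :=
  ifns_stat_cvg mu nu (log_mean u m) a.

Definition log_slowly_oscillating (R : realType) (N : lmodType R)
    (mu nu : N -> R -> R) (u : nat -> N) : Prop :=
  forall t eps : R, 0 < t -> 0 < eps < 1 ->
    exists lambda : R, exists m0 : nat, 1 < lambda /\
      forall n k : nat, (m0 <= n)%N -> (n < k)%N ->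
        k%:Z <= Num.floor (n%:R `^ lambda : R) ->
        1 - eps < mu (u k - u n) t /\ nu (u k - u n) t < eps.

(* Main.v *)
(** For fixed [eps] in ]0, 1[, the gauge
    [p w = inf {t | 1 - eps < mu w t and nu w t < eps}] is a seminorm, and
    convergence in the IFNS is convergence for all these gauges, so everything
    reduces to a Tauberian theorem for one seminorm [p].  Let
    [l k = 1 + 1/2 + ... + 1/k] and let [L v] be the logarithmic mean of [v].
    - Slow oscillation of [v] makes [p (L v - v)] bounded, which in turn makes
      [L v] slowly oscillating; hence all the iterated means oscillate slowly.
    - A statistically convergent, slowly oscillating sequence converges: for
      large [n] some [k] in ]n, 2n] is a good index, and [2n] is much smaller
      than [n ^ lambda].
    - If [L v] tends to [a] and [v] oscillates slowly, then [v] tends to [a]: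
      the mean of [v] over ]n, k] with [l k ~ lambda * l n] is a combination of
      [L v k] and [L v n] with bounded coefficients, and it is close to [v n].
    The last point, applied [m] times, descends from the [m]-th mean to [u]. *)

Require Import Defs.
From mathcomp Require Import all_boot all_order all_algebra.
From mathcomp Require Import all_classical all_reals all_analysis.
From mathcomp Require Import ring lra zify.

Set Implicit Arguments.
Unset Strict Implicit.
Unset Printing Implicit Defensive.

Import Order.TTheory GRing.Theory Num.Theory.
Import numFieldNormedType.Exports.

Local Open Scope classical_set_scope.
Local Open Scope ring_scope.

(** * Growth of the harmonic weights and comparison with the logarithm *)

Lemma log_weightS (R : realType) (n : nat) :
  log_weight R n.+1 = log_weight R n + n.+1%:R^-1.
Proof. by rewrite /log_weight big_nat_recr. Qed.

Lemma log_weight_le (R : realType) (n k : nat) :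
  (n <= k)%N -> log_weight R n <= log_weight R k.
Proof.
elim: k => [|k IH]; first by rewrite leqn0 => /eqP ->.
rewrite leq_eqVlt => /orP[/eqP -> //|/IH/le_trans]; apply.
by rewrite log_weightS lerDl invr_ge0.
Qed.

Lemma log_weight_ge0 (R : realType) (n : nat) : 0 <= log_weight R n.
Proof. by apply: sumr_ge0 => j _; rewrite invr_ge0. Qed.

Lemma log_weight_gt0 (R : realType) (n : nat) :
  (0 < n)%N -> 0 < log_weight R n.
Proof.
case: n => // n _; rewrite log_weightS.
by rewrite ltr_wpDl ?log_weight_ge0// invr_gt0.
Qed.

Lemma log_weightS_le (R : realType) (n : nat) :
  log_weight R n.+1 <= log_weight R n + 1.
Proof. by rewrite log_weightS lerD2l invf_le1 ?ler1n ?ltr0n. Qed.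

(** Each of the [n] new terms is at most [1 / n]. *)
Lemma log_weight_double (R : realType) (n : nat) :
  log_weight R (n + n) <= log_weight R n + 1.
Proof.
case: n => [|n]; first by rewrite lerDl.
suff H i : log_weight R (n.+1 + i) <= log_weight R n.+1 + i%:R / n.+1%:R.
  by have := H n.+1; rewrite divff ?pnatr_eq0.
elim: i => [|i IH]; first by rewrite addn0 mul0r addr0.
rewrite addnS log_weightS -[i.+1%:R]natr1 mulrDl mul1r addrA lerD//.
by rewrite lef_pV2 ?posrE ?ltr0n// ler_nat; lia.
Qed.

(** Both bounds are [ln (1 + x) <= x], at [x = - 1 / (n + 2)] and at [x = 1 / (n + 1)]; summed over
    [n], they compare [ln] with [log_weight]. *)
Lemma ln_succ_bounds (R : realType) (n : nat) :
  n.+2%:R^-1 <= ln (n.+2%:R : R) - ln n.+1%:R <= n.+1%:R^-1.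
Proof.
have p1 : 0 < n.+1%:R :> R by rewrite ltr0n.
have p2 : 0 < n.+2%:R :> R by rewrite ltr0n.
have e : n.+2%:R = n.+1%:R + 1 :> R by rewrite natr1.
have i1 : 0 < n.+1%:R^-1 :> R by rewrite invr_gt0.
have i2 : n.+2%:R^-1 < 1 :> R by rewrite invf_lt1// ltr1n.
apply/andP; split.
  suff: ln (n.+1%:R : R) - ln n.+2%:R <= - n.+2%:R^-1 by rewrite lerNr opprB.
  rewrite -ln_div ?posrE//.
  have -> : n.+1%:R / n.+2%:R = 1 + - n.+2%:R^-1 :> R.
    rewrite e; move: p1; move: (n.+1%:R : R) => x x0.
    by field; rewrite gt_eqF//; lra.
  by apply: le_ln1Dx; rewrite ltrN2.
rewrite -ln_div ?posrE//.
have -> : n.+2%:R / n.+1%:R = 1 + n.+1%:R^-1 :> R.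
  rewrite e; move: p1; move: (n.+1%:R : R) => x x0.
  by field; rewrite gt_eqF.
by apply: le_ln1Dx; rewrite (lt_trans _ i1)// ltrN10.
Qed.

Lemma ln_le_log_weight (R : realType) (n : nat) : ln (n.+1%:R : R) <= log_weight R n.
Proof.
elim: n => [|n IH]; first by rewrite ln1 log_weight_ge0.
have /andP[_ h] := ln_succ_bounds R n.
by have := lerD IH h; rewrite subrKC -log_weightS.
Qed.

Lemma log_weight_le_ln (R : realType) (n : nat) :
  log_weight R n.+1 <= 1 + ln n.+1%:R.
Proof.
elim: n => [|n IH].
  by rewrite log_weightS /log_weight big_geq// ln1 add0r invr1 addr0.
have /andP[h _] := ln_succ_bounds R n.
by have := lerD IH h; rewrite -addrA subrKC -log_weightS.
Qed.

Lemma log_weight_unbounded (R : realType) (x : R) :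
  exists n, x < log_weight R n.
Proof.
exists (Num.bound (expR x)); apply: lt_le_trans (ln_le_log_weight R _).
rewrite -ltr_expR lnK ?posrE ?ltr0n//.
apply: lt_trans (archi_boundP (expR_ge0 x)) _.
by rewrite ltr_nat.
Qed.

Lemma log_weight_eventually_ge (R : realType) (x : R) :
  exists n0, forall n, (n0 <= n)%N -> x <= log_weight R n.
Proof.
have [n0 hn0] := log_weight_unbounded x.
by exists n0 => n /(log_weight_le R) h; apply: le_trans h; apply: ltW.
Qed.

(** A discrete intermediate value property: the weight grows by steps of at most 1, so the last
    index with weight at most [x] misses [x] by less than 1. *)
Lemma log_weight_select (R : realType) (n0 : nat) (x : R) :
  log_weight R n0 <= x ->
  exists k, [/\ (n0 <= k)%N, log_weight R k <= x & x < log_weight R k + 1].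
Proof.
move=> hx; have [m hm] := log_weight_unbounded x.
have P0 : exists n, log_weight R n <= x by exists n0.
have Pm n : log_weight R n <= x -> (n <= m)%N.
  move=> hn; rewrite leqNgt; apply/negP => /ltnW /(log_weight_le R).
  by move=> /(lt_le_trans hm); rewrite ltNge hn.
have [k hk kmax] := ex_maxnP P0 Pm.
exists k; split=> //; first exact: kmax.
apply: lt_le_trans (log_weightS_le R k).
by rewrite ltNge; apply/negP => /kmax; rewrite ltnn.
Qed.

(** * Seminorms and logarithmic sums *)

Record seminorm_axioms (R : realType) (N : lmodType R) (p : N -> R) : Prop := {
  seminormD : forall u w : N, p (u + w) <= p u + p w;
  seminormZ : forall (c : R) (u : N), p (c *: u) = `|c| * p u
}.

Lemma seminorm0 (R : realType) (N : lmodType R) (p : N -> R) :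
  seminorm_axioms p -> p 0 = 0.
Proof. by move=> hp; rewrite -(scale0r 0) (seminormZ hp) normr0 mul0r. Qed.

Lemma seminormN (R : realType) (N : lmodType R) (p : N -> R) (u : N) :
  seminorm_axioms p -> p (- u) = p u.
Proof. by move=> hp; rewrite -scaleN1r (seminormZ hp) normrN1 mul1r. Qed.

Lemma seminormB (R : realType) (N : lmodType R) (p : N -> R) (u w : N) :
  seminorm_axioms p -> p (u - w) <= p u + p w.
Proof. by move=> hp; rewrite -(seminormN w hp) (seminormD hp). Qed.

Lemma seminorm_ge0 (R : realType) (N : lmodType R) (p : N -> R) (u : N) :
  seminorm_axioms p -> 0 <= p u.
Proof.
move=> hp; have := seminormB u u hp; rewrite subrr seminorm0//.
by rewrite -mulr2n pmulrn_lge0.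
Qed.

Lemma seminormBC (R : realType) (N : lmodType R) (p : N -> R) (u w : N) :
  seminorm_axioms p -> p (u - w) = p (w - u).
Proof. by move=> hp; rewrite -(seminormN _ hp) opprB. Qed.

Lemma seminorm_triangle (R : realType) (N : lmodType R) (p : N -> R)
  (v u w : N) : seminorm_axioms p -> p (u - w) <= p (u - v) + p (v - w).
Proof. by move=> hp; rewrite -(subrKA v u) (seminormD hp). Qed.

Lemma seminorm_log_sum_le (R : realType) (N : lmodType R) (p : N -> R)
  (x : nat -> N) (B : R) (n k : nat) :
  seminorm_axioms p -> (n <= k)%N ->
  (forall j, (n < j <= k)%N -> p (x j) <= B) ->
  p (\sum_(n.+1 <= j < k.+1) j%:R^-1 *: x j)
    <= B * (log_weight R k - log_weight R n).
Proof.
move=> hp; elim: k => [|k IH].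
  rewrite leqn0 => /eqP -> _.
  by rewrite big_geq// seminorm0// subrr mulr0.
rewrite leq_eqVlt => /orP[/eqP -> _|nk hB].
  by rewrite big_geq// seminorm0// subrr mulr0.
rewrite big_nat_recr//= log_weightS.
apply: le_trans (seminormD hp _ _) _.
rewrite addrAC mulrDr lerD//.
  by apply: IH => // j /andP[h1 h2]; apply: hB; rewrite h1 ltnW.
rewrite (seminormZ hp) ger0_norm ?invr_ge0// mulrC ler_wpM2r ?invr_ge0//.
by apply: hB; rewrite nk leqnn.
Qed.

(** The centre [c] is left free: it is taken to be [v n], [v k] or a mean, according to the term to
    be cancelled or made small. *)
Lemma log_mean1_split (R : realType) (N : lmodType R) (v : nat -> N) (c : N)
  (n k : nat) : (n <= k)%N ->
  log_weight R k *: (log_mean v 1 k - c) =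
  log_weight R n *: (log_mean v 1 n - c)
    + \sum_(n.+1 <= j < k.+1) j%:R^-1 *: (v j - c).
Proof.
have H i : log_weight R i *: (log_mean v 1 i - c) =
    \sum_(1 <= j < i.+1) j%:R^-1 *: (v j - c).
  under eq_bigr do rewrite scalerBr.
  rewrite sumrB -scaler_suml /= scalerBr; congr (_ - _).
  case: i => [|i]; first by rewrite !big_geq// !scaler0.
  by rewrite scalerA divff ?scale1r// gt_eqF ?log_weight_gt0.
by move=> nk; rewrite !H (@big_cat_nat _ _ _ n.+1).
Qed.

(** * Tauberian argument for one seminorm *)

Definition seminorm_cvg (R : realType) (N : lmodType R) (p : N -> R)
    (v : nat -> N) (a : N) : Prop :=
  forall t : R, 0 < t ->
    exists k0, forall k, (k0 <= k)%N -> p (v k - a) <= t.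

(* Since [log_weight n ~ ln n], the range [k <= n ^ lambda] is traded for
   [log_weight k <= L * log_weight n], which frees the Tauberian argument from
   real powers. *)
Definition weight_slowly_oscillating (R : realType) (N : lmodType R)
    (p : N -> R) (v : nat -> N) : Prop :=
  forall t : R, 0 < t -> exists (L : R) (m0 : nat), 1 < L /\
    forall n k, (m0 <= n)%N -> (n <= k)%N ->
      log_weight R k <= L * log_weight R n -> p (v k - v n) <= t.

(* Strong induction: for [k < n] with [log_weight k ~ q * log_weight n] and
   [1 / L < q < 1], splitting the mean at [k] bounds the quantity at [n] by
   [q] times the one at [k] plus [1], so [1 / (1 - q)] is a stable bound. *)
Lemma slowly_oscillating_mean_bounded (R : realType) (N : lmodType R)
  (p : N -> R) (v : nat -> N) :
  seminorm_axioms p -> weight_slowly_oscillating p v ->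
  exists C, forall n, p (log_mean v 1 n - v n) <= C.
Proof.
move=> hp /(_ _ ltr01)[L [m0 [L1 hv]]].
have [q [q0 q1 qL]] : exists q : R, [/\ 0 < q, q < 1 & 1 < q * L].
  have L0 : 0 < L^-1 by rewrite invr_gt0; lra.
  have L2 : L^-1 < 1 by rewrite invf_lt1//; lra.
  exists ((1 + L^-1) / 2); split; try lra.
  have -> : (1 + L^-1) / 2 * L = (L + 1) / 2 by field; rewrite gt_eqF//; lra.
  lra.
have hm0 := log_weight_ge0 R m0.
(* Beyond [M], [q * log_weight n] exceeds [log_weight m0], so that some [k >= m0] can be selected,
   and [(q * L - 1) * log_weight n >= L] absorbs the unit lost in selecting it. *)
have [M hM] := log_weight_eventually_ge
  (log_weight R m0 / q + L / (q * L - 1) + 1).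
set D := fun n => p (log_mean v 1 n - v n).
have D0 n : 0 <= D n by exact: seminorm_ge0.
pose S := \sum_(i < M) D i.
have S0 : 0 <= S by apply: sumr_ge0.
have q1' : 0 < (1 - q)^-1 by rewrite invr_gt0 subr_gt0.
exists (S + (1 - q)^-1) => n.
rewrite -/(D n); elim/ltn_ind: n => n IH.
case: (ltnP n M) => [nM|/hM hn].
  have : D n <= S by rewrite /S (bigD1 (Ordinal nM))//= lerDl sumr_ge0.
  lra.
have h1 : 0 <= log_weight R m0 / q by rewrite divr_ge0// ltW.
have h2 : 0 <= L / (q * L - 1) by apply: divr_ge0; lra.
have h3 : log_weight R m0 <= q * log_weight R n.
  by rewrite mulrC -ler_pdivrMr//; lra.
have h4 : L <= log_weight R n * (q * L - 1).
  by rewrite -ler_pdivrMr; lra.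
have [k [m0k kq qk]] := log_weight_select h3.
have n0 : 0 < log_weight R n by lra.
have kn : (k < n)%N.
  rewrite ltnNge; apply/negP => /(log_weight_le R) h.
  by have : 0 < (1 - q) * log_weight R n; [rewrite mulr_gt0// subr_gt0|lra].
have nk : log_weight R n <= L * log_weight R k by nra.
have vnk : p (log_mean v 1 k - v n) <= D k + 1.
  apply: le_trans (seminorm_triangle (v k) _ _ hp) _.
  by rewrite lerD// (seminormBC _ _ hp) hv// ltnW.
have hs : p (\sum_(k.+1 <= j < n.+1) j%:R^-1 *: (v j - v n))
    <= 1 * (log_weight R n - log_weight R k).
  apply: seminorm_log_sum_le => //; first exact: ltnW.
  move=> j /andP[kj jn]; rewrite (seminormBC _ _ hp) hv//.
    by rewrite (leq_trans m0k)// ltnW.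
  by apply: (le_trans nk); rewrite ler_wpM2l ?log_weight_le 1?ltnW//; lra.
have := log_mean1_split v (v n) (ltnW kn) => /(congr1 p).
rewrite (seminormZ hp) ger0_norm ?log_weight_ge0// -/(D n) => e.
have : log_weight R n * D n <= log_weight R k * (D k + 1)
    + (log_weight R n - log_weight R k).
  rewrite e; apply: le_trans (seminormD hp _ _) _.
  rewrite (seminormZ hp) ger0_norm ?log_weight_ge0// lerD//; last by lra.
  by rewrite ler_wpM2l ?log_weight_ge0.
have := IH k kn.
set C := S + _ => hk hnk.
(* The right side is [log_weight k * D k + log_weight n], at most [(q * C + 1) * log_weight n], and
   [1 <= (1 - q) * C]. *)
rewrite -(ler_pM2l n0); apply: (le_trans hnk).
have C0 : 0 <= C by rewrite /C; lra.
have hC : 1 <= (1 - q) * C.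
  by rewrite /C mulrDr divff ?gt_eqF ?subr_gt0// lerDr mulr_ge0// subr_ge0 ltW.
have lk := log_weight_ge0 R k.
have a1 : log_weight R k * D k <= log_weight R k * C by rewrite ler_wpM2l.
have a2 : log_weight R k * C <= q * log_weight R n * C by rewrite ler_wpM2r.
have a3 : log_weight R n <= log_weight R n * ((1 - q) * C).
  by rewrite ler_peMr// ltW.
nra.
Qed.

(** Centring the split at the mean at [n] kills its first term; every remaining [v j] is within
    [1 + C] of that mean. *)
Lemma log_mean1_slowly_oscillating (R : realType) (N : lmodType R)
  (p : N -> R) (v : nat -> N) :
  seminorm_axioms p -> weight_slowly_oscillating p v ->
  weight_slowly_oscillating p (log_mean v 1).
Proof.
move=> hp hv t t0; have [C hC] := slowly_oscillating_mean_bounded hp hv.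
have [L [m0 [L1 {}hv]]] := hv _ ltr01.
have C0 : 0 <= C by apply: le_trans (hC 0%N); exact: seminorm_ge0.
have C1 : 0 < 1 + C by lra.
have tC : 0 < t / (1 + C) by rewrite divr_gt0.
(* The second bound gives [(1 + C) * (log_weight k - log_weight n) <= t * log_weight n]. *)
exists (Num.min L (1 + t / (1 + C))), (maxn m0 1); split.
  by rewrite lt_min L1/=; lra.
move=> n k; rewrite geq_max => /andP[m0n n0] nk.
rewrite minr_pMl ?log_weight_ge0// le_min => /andP[kL kt].
have n0' := log_weight_gt0 R n0.
have k0' : 0 < log_weight R k := lt_le_trans n0' (log_weight_le R nk).
have hs : p (\sum_(n.+1 <= j < k.+1) j%:R^-1 *: (v j - log_mean v 1 n))
    <= (1 + C) * (log_weight R k - log_weight R n).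
  apply: seminorm_log_sum_le => // j /andP[nj jk].
  apply: le_trans (seminorm_triangle (v n) _ _ hp) _.
  rewrite lerD//; last by rewrite (seminormBC _ _ hp).
  by rewrite hv// ?(le_trans (log_weight_le R jk))// ltnW.
have := log_mean1_split v (log_mean v 1 n) nk => /(congr1 p).
rewrite subrr scaler0 add0r (seminormZ hp) ger0_norm ?log_weight_ge0// => e.
rewrite -(ler_pM2l k0') e (le_trans hs)//.
have : (1 + C) * (log_weight R k - log_weight R n)
    <= (1 + C) * (t / (1 + C) * log_weight R n) by rewrite ler_pM2l//; lra.
have -> : (1 + C) * (t / (1 + C) * log_weight R n) = t * log_weight R n.
  by field; rewrite gt_eqF.
move=> /le_trans; apply; rewrite mulrC ler_pM2r// log_weight_le//.
Qed.

Lemma log_mean_slowly_oscillating (R : realType) (N : lmodType R)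
  (p : N -> R) (v : nat -> N) (m : nat) :
  seminorm_axioms p -> weight_slowly_oscillating p v ->
  weight_slowly_oscillating p (log_mean v m).
Proof.
move=> hp hv; elim: m => // m IH.
(* [log_mean v m.+1] is convertible to [log_mean (log_mean v m) 1]. *)
exact: (log_mean1_slowly_oscillating hp IH).
Qed.

Lemma log_mean1_tauberian (R : realType) (N : lmodType R)
  (p : N -> R) (v : nat -> N) (a : N) :
  seminorm_axioms p -> weight_slowly_oscillating p v ->
  seminorm_cvg p (log_mean v 1) a -> seminorm_cvg p v a.
Proof.
move=> hp hv hL t t0.
have [|L [m0 [L1 {}hv]]] := hv (t / 2); first by lra.
(* The two means are weighted by at most [(L + 1) * log_weight n] in total, so this tolerance leaves
   an error of [t * (L - 1) / 4 * log_weight n]. *)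
have [|k0 {}hL] := hL (t * (L - 1) / (4 * (L + 1))).
  by rewrite divr_gt0 ?mulr_gt0//; lra.
(* Ensures [log_weight k - log_weight n >= (L - 1) / 2 * log_weight n] despite the unit lost in
   selecting [k]. *)
have [k1 hk1] := log_weight_eventually_ge (2 / (L - 1) + 1).
exists (maxn m0 (maxn k0 k1)) => n; rewrite !geq_max => /and3P[m0n k0n /hk1 hn].
have i0 : 0 < 2 / (L - 1) by rewrite divr_gt0//; lra.
have hn2 : 2 <= log_weight R n * (L - 1) by rewrite -ler_pdivrMr; lra.
have [|k [nk kL Lk]] := @log_weight_select R n (L * log_weight R n).
  by rewrite ler_peMl ?log_weight_ge0// ltW.
have hs : p (\sum_(n.+1 <= j < k.+1) j%:R^-1 *: (v j - v n))
    <= t / 2 * (log_weight R k - log_weight R n).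
  apply: seminorm_log_sum_le => // j /andP[nj jk].
  by rewrite hv// ?(le_trans (log_weight_le R jk))// ltnW.
(* The split centred at [v n], with the means recentred at [a] and solved for [v n - a]. *)
have e : (log_weight R k - log_weight R n) *: (v n - a) =
    log_weight R k *: (log_mean v 1 k - a)
    - log_weight R n *: (log_mean v 1 n - a)
    - \sum_(n.+1 <= j < k.+1) j%:R^-1 *: (v j - v n).
  have E x : x - a = x - v n + (v n - a) by rewrite subrKA.
  have Z (A B C D : N) : B - C = A + D + B - (A + C) - D.
    by rewrite -(addrA A) (addrC A) addrKA -(addrA D) addrAC subrr add0r.
  rewrite (E (log_mean v 1 k)) (E (log_mean v 1 n)) scalerBl.
  by rewrite ![_ *: (_ - v n + _)]scalerDr (log_mean1_split _ _ nk) -Z.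
have kn : 0 < log_weight R k - log_weight R n by lra.
have n0 : 0 < log_weight R n by lra.
set d := t * (L - 1) / _ in hL.
have hd : d * (L + 1) = t * (L - 1) / 4.
  by rewrite /d; field; rewrite gt_eqF//; lra.
have : (log_weight R k - log_weight R n) * p (v n - a) <=
  log_weight R k * d + log_weight R n * d
    + t / 2 * (log_weight R k - log_weight R n).
  rewrite -[X in X * p _](ger0_norm (ltW kn)) -(seminormZ hp) e.
  apply: le_trans (seminormB _ _ hp) _; rewrite lerD//.
  apply: le_trans (seminormB _ _ hp) _.
  rewrite !(seminormZ hp) !ger0_norm ?log_weight_ge0//.
  by rewrite lerD// ler_wpM2l ?log_weight_ge0// hL// (leq_trans k0n).
move=> h; rewrite -(ler_pM2l kn); apply: (le_trans h).
have d0 : 0 < d by rewrite /d divr_gt0 ?mulr_gt0//; lra.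
have b1 : log_weight R k * d <= L * log_weight R n * d by rewrite ler_pM2r.
have b2 : L * log_weight R n * d + log_weight R n * d
    = log_weight R n * (t * (L - 1) / 4) by rewrite -hd; ring.
have b3 : 0 <= t * (log_weight R k - log_weight R n
    - log_weight R n * (L - 1) / 2) by rewrite mulr_ge0//; lra.
lra.
Qed.

Lemma log_mean_tauberian (R : realType) (N : lmodType R)
  (p : N -> R) (v : nat -> N) (a : N) (m : nat) :
  seminorm_axioms p -> weight_slowly_oscillating p v ->
  seminorm_cvg p (log_mean v m) a -> seminorm_cvg p v a.
Proof.
move=> hp hv; elim: m => // m IH h; apply: IH.
by apply: log_mean1_tauberian (log_mean_slowly_oscillating m hp hv) _.
Qed.

(** * From statistical to ordinary convergence *)

Lemma density0_dyadic (R : realType) (P : pred nat) :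
  (n%:R^-1 * (count P (index_iota 1 n.+1))%:R : R) @[n --> \oo] --> (0 : R) ->
  exists n0, forall n, (n0 <= n)%N ->
    exists2 k, (n < k <= n + n)%N & ~~ P k.
Proof.
move=> /cvgrPdist_lt /(_ (2^-1)) []; first by rewrite invr_gt0.
move=> M _ hM; exists M.+1 => n hn.
(* If [P] held on all of ]n, 2n], its frequency up to [n + n] would be at least 1/2. *)
apply: contrapT => hP.
have all_P : all P (index_iota n.+1 (n + n).+1).
  apply/allP => k; rewrite mem_index_iota => /andP[nk kn].
  by apply: contrapT => /negP nP; apply: hP; exists k => //; rewrite nk.
have hc : (n <= count P (index_iota 1 (n + n).+1))%N.
  have -> : index_iota 1 (n + n).+1 =
      index_iota 1 n.+1 ++ index_iota n.+1 (n + n).+1.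
    by rewrite /index_iota !subSS !subn0 addKn iotaD add1n.
  rewrite count_cat.
  have -> : count P (index_iota n.+1 (n + n).+1) = n.
    by move: all_P; rewrite all_count size_iota subSS addKn => /eqP.
  exact: leq_addl.
have /= := hM (n + n)%N; have -> : (M <= n + n)%N by lia.
move=> /(_ isT); apply/negP; rewrite -leNgt sub0r normrN.
rewrite ger0_norm ?mulr_ge0 ?invr_ge0//.
have n0 : 0 < n%:R :> R by rewrite ltr0n; lia.
rewrite mulrC ler_pdivlMr ?natrD; last by lra.
have : n%:R <= (count P (index_iota 1 (n + n).+1))%:R :> R by rewrite ler_nat.
by move=> h; lra.
Qed.

Lemma slowly_oscillating_dyadic_cvg (R : realType) (N : lmodType R)
  (p : N -> R) (v : nat -> N) (a : N) :
  seminorm_axioms p -> weight_slowly_oscillating p v ->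
  (forall t : R, 0 < t -> exists n0, forall n, (n0 <= n)%N ->
     exists2 k, (n < k <= n + n)%N & p (v k - a) <= t) ->
  seminorm_cvg p v a.
Proof.
move=> hp hv hd t t0; have t2 : 0 < t / 2 by lra.
have [L [m0 [L1 {}hv]]] := hv _ t2; have [n0 {}hd] := hd _ t2.
(* Then [log_weight n + 1 <= L * log_weight n], which covers the block ]n, 2n]. *)
have [n1 hn1] := log_weight_eventually_ge (L - 1)^-1.
exists (maxn m0 (maxn n0 n1)) => n; rewrite !geq_max => /and3P[m0n n0n /hn1 hn].
have [k /andP[nk kn] pk] := hd n n0n.
have L1' : 0 < L - 1 by lra.
have h1 : 1 <= log_weight R n * (L - 1).
  by rewrite -ler_pdivrMr// div1r.
have hk : p (v n - v k) <= t / 2.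
  rewrite (seminormBC _ _ hp) hv//; first exact: ltnW.
  apply: le_trans (log_weight_le R kn) _.
  by apply: le_trans (log_weight_double R n) _; lra.
by have := seminorm_triangle (v k) (v n) a hp; lra.
Qed.

(** * Gauges of the intuitionistic fuzzy norm *)

Definition ifns_ball (R : realType) (N : lmodType R) (mu nu : N -> R -> R)
    (eps : R) (u : N) (t : R) : Prop := 1 - eps < mu u t /\ nu u t < eps.

(** [ifns_ball mu nu eps u] is read as a set of radii [t]. *)
Definition ifns_gauge (R : realType) (N : lmodType R) (mu nu : N -> R -> R)
    (eps : R) (u : N) : R := inf (ifns_ball mu nu eps u).

Section Gauge.
Context (R : realType) (N : lmodType R) (mu nu : N -> R -> R) (eps : R).
Hypotheses (hN : IFNS mu nu) (eps01 : 0 < eps < 1).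

Local Notation ball := (ifns_ball mu nu eps).
Local Notation gauge := (ifns_gauge mu nu eps).

Lemma ifns_ball_gt0 (u : N) (t : R) : ball u t -> 0 < t.
Proof.
move=> [h _]; rewrite ltNge; apply/negP => /(ifns_mu_le0 hN u) e.
by move: h eps01; rewrite e => h /andP[_ ?]; lra.
Qed.

(** Since the axioms use min and max, [eps] does not degrade under addition; hence the gauge is
    subadditive. *)
Lemma ifns_ballD (u w : N) (t s : R) :
  ball u t -> ball w s -> ball (u + w) (t + s).
Proof.
move=> [ut1 ut2] [ws1 ws2]; split.
  by apply: lt_le_trans (ifns_muD hN u w t s); rewrite lt_min ut1.
by apply: le_lt_trans (ifns_nuD hN u w t s) _; rewrite gt_max ut2.
Qed.

Lemma ifns_ball0 (t : R) : 0 < t -> ball 0 t.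
Proof.
move=> t0; rewrite /ifns_ball.
have -> := (ifns_mu_eq1 hN 0).2 erefl t t0.
have -> := (ifns_nu_eq0 hN 0).2 erefl t t0.
by have /andP[? _] := eps01; split=> //; rewrite gtrBl.
Qed.

Lemma ifns_ballZ (c : R) (u : N) (t : R) :
  c != 0 -> ball u t -> ball (c *: u) (`|c| * t).
Proof.
move=> c0 ut; have t0 := ifns_ball_gt0 ut.
have c1 : 0 < `|c| by rewrite normr_gt0.
rewrite /ifns_ball (ifns_muZ hN)// ?(ifns_nuZ hN)// ?mulr_gt0//.
by rewrite mulrC mulKf// gt_eqF.
Qed.

(** Monotonicity in the radius comes from adding the zero vector with radius [s - t]. *)
Lemma ifns_ball_le (u : N) (t s : R) : ball u t -> t <= s -> ball u s.
Proof.
move=> ut; rewrite le_eqVlt => /orP[/eqP <- //|ts].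
have := ifns_ballD ut (@ifns_ball0 (s - t) _).
by rewrite addr0 subrKC; apply; rewrite subr_gt0.
Qed.

Lemma ifns_ball_nonempty (u : N) : ball u !=set0.
Proof.
have /cvgrPdist_lt/(_ eps) h1 := ifns_mu_pinfty hN u.
have /cvgrPdist_lt/(_ eps) h2 := ifns_nu_pinfty hN u.
have /andP[e0 _] := eps01.
near (pinfty_nbhs R) => t; exists t; split.
  have : `|1 - mu u t| < eps by near: t; exact: h1.
  by have := ler_norm (1 - mu u t); lra.
have : `|0 - nu u t| < eps by near: t; exact: h2.
by rewrite distrC; have := ler_norm (nu u t - 0); lra.
Unshelve. all: by end_near. Qed.

Lemma ifns_gauge_le (u : N) (t : R) : ball u t -> gauge u <= t.
Proof. by apply: ge_inf; exists 0 => s /ifns_ball_gt0/ltW. Qed.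

Lemma ifns_gauge_lt (u : N) (t : R) : gauge u < t -> ball u t.
Proof.
move=> /(inf_lt (ifns_ball_nonempty u)) [s us st].
exact: ifns_ball_le us (ltW st).
Qed.

Lemma ifns_gauge0 : gauge 0 = 0.
Proof.
apply/eqP; rewrite eq_le; apply/andP; split.
  apply/ler_addgt0Pr => e e0; rewrite add0r ifns_gauge_le//.
  exact: ifns_ball0.
by apply: lb_le_inf (ifns_ball_nonempty _) _ => s /ifns_ball_gt0/ltW.
Qed.

Lemma ifns_gauge_seminorm : seminorm_axioms gauge.
Proof.
have leZ c u : c != 0 -> gauge (c *: u) <= `|c| * gauge u.
  move=> c0; have c1 : 0 < `|c| by rewrite normr_gt0.
  apply/ler_addgt0Pr => e e0.
  have -> : `|c| * gauge u + e = `|c| * (gauge u + e / `|c|).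
    by field; rewrite gt_eqF.
  apply/ifns_gauge_le/ifns_ballZ/ifns_gauge_lt => //.
  by rewrite ltrDl divr_gt0.
split=> [u w|c u].
  apply/ler_addgt0Pr => e e0.
  have -> : gauge u + gauge w + e = (gauge u + e / 2) + (gauge w + e / 2) by lra.
  by apply/ifns_gauge_le/ifns_ballD; apply: ifns_gauge_lt; lra.
have [->|c0] := eqVneq c 0; first by rewrite scale0r ifns_gauge0 normr0 mul0r.
apply/eqP; rewrite eq_le leZ//=.
have c1 : 0 < `|c| by rewrite normr_gt0.
(* The reverse inequality is [leZ] for the inverse scalar. *)
have := leZ c^-1 (c *: u); rewrite scalerA mulVf// scale1r invr_eq0 => /(_ c0).
by rewrite normfV mulrC ler_pdivlMr// mulrC.
Qed.

Lemma ifns_stat_cvg_dyadic (v : nat -> N) (a : N) : ifns_stat_cvg mu nu v a ->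
  forall t : R, 0 < t -> exists n0, forall n, (n0 <= n)%N ->
    exists2 k, (n < k <= n + n)%N & gauge (v k - a) <= t.
Proof.
move=> hv t t0; have /andP[e0 _] := eps01.
have [n0 hn0] := density0_dyadic (hv _ _ e0 t0).
exists n0 => n /hn0 [k nk]; rewrite negb_or -!ltNge => /andP[h1 h2].
by exists k => //; apply: ifns_gauge_le.
Qed.

Lemma log_slowly_oscillating_weight (u : nat -> N) :
  log_slowly_oscillating mu nu u -> weight_slowly_oscillating gauge u.
Proof.
move=> hu t t0; have [lam [m0 [lam1 {}hu]]] := hu _ _ t0 eps01.
(* The gap between [L] and [lam] absorbs the 1 in [log_weight n <= 1 + ln n]:
   [ln k <= L * (1 + ln n) <= lam * ln n] for large [n]. *)
pose L := (1 + lam) / 2; have L1 : 1 < L by rewrite /L; lra.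
have Ll : 0 < lam - L by rewrite /L; lra.
have [m1 hm1] := log_weight_eventually_ge (L / (lam - L) + 1).
exists L, (maxn m0 (maxn m1 1)); split=> // n k.
rewrite !geq_max => /and3P[m0n /hm1 hn n0].
rewrite leq_eqVlt => /orP[/eqP <- _|nk kL].
  by rewrite subrr ifns_gauge0 ltW.
apply: ifns_gauge_le; apply: hu => //.
have n0' : 0 < n%:R :> R by rewrite ltr0n.
have k0 : 0 < k%:R :> R by rewrite ltr0n; lia.
rewrite floor_ge_int /powR gt_eqF// -[X in X <= _](@lnK R k%:R)// ler_expR.
have ln_k : ln k%:R <= log_weight R k.
  by apply: le_trans (ln_le_log_weight R k); rewrite ler_ln ?posrE ?ltr0Sn// ler_nat.
have ln_n : log_weight R n <= 1 + ln n%:R.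
  by case: n n0 {hn m0n nk kL n0'} => // n _; exact: log_weight_le_ln.
have h : L <= ln n%:R * (lam - L) by rewrite -ler_pdivrMr//; lra.
have : L * log_weight R n <= L * (1 + ln n%:R) by rewrite ler_pM2l//; lra.
lra.
Qed.

End Gauge.

Theorem theorem3p10 (R : realType) (N : lmodType R) (mu nu : N -> R -> R)
  (hN : IFNS mu nu) (u : nat -> N) (a : N) (m : nat) (hm : (1 <= m)%N)
  (hsum : stat_log_summable mu nu m u a)
  (hosc : log_slowly_oscillating mu nu u) :
  ifns_cvg mu nu u a.
Proof.
move=> eps t eps0 t0.
(* The gauge needs a level below 1, while [eps] is any positive real. *)
have e01 : 0 < Num.min eps (1 / 2) < 1.
  by rewrite lt_min gt_min eps0/=; apply/andP; split; [|apply/orP; right]; lra.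
have hp := ifns_gauge_seminorm hN e01.
have hu := log_slowly_oscillating_weight hN e01 hosc.
(* Halving [t] turns the large inequality into the strict one that [ifns_gauge_lt] requires. *)
have [|k0 hk0] := log_mean_tauberian hp hu (slowly_oscillating_dyadic_cvg hp
  (log_mean_slowly_oscillating m hp hu) (ifns_stat_cvg_dyadic hN e01 hsum))
  (t := t / 2); first by lra.
exists k0 => k /hk0 hk.
have [h1 h2] : ifns_ball mu nu (Num.min eps (1 / 2)) (u k - a) t.
  by apply: (ifns_gauge_lt hN e01); lra.
move: h2; rewrite lt_min => /andP[h2 _]; split=> //.
by apply: le_lt_trans h1; rewrite lerB// ge_min lexx.
Qed.
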